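(* Let $(R,\delta)$ be an $m_1$-inverse loop with permutation $J_R:R\to R$ such that $J_R(\delta)=\delta$ and $J_R^{h_1}\in\mathrm{Aut}(R)$, and let $(S,\delta)$ be an $m_2$-inverse loop with permutation $J_S:S\to S$ such that $J_S(\delta)=\delta$ and $J_S^{h_2}\in\mathrm{Aut}(S)$ (with $m_1,m_2,h_1,h_2\in\mathbb{Z}$). Let $\phi:S\times R\to R$ and $\psi:S\times R\to S$ be maps satisfying \begin{align*} &\phi(\delta,r)=r,\quad \phi(s,\delta)=\delta,\qquad \psi(\delta,r)=\delta,\quad \psi(s,\delta)=s,\\ &\phi(s,\phi(J_S(s),r))=r,\\ &\psi\big(\psi(s,J_R^m(rr')),J_R^{m+1}(r)\big)=\psi(s,J_R^m(r')),\\ &\phi(s,J_R^m(rr'))\,\phi\big(\psi(s,J_R^m(rr')),J_R^{m+1}(r)\big)=\phi(s,J_R^m(r')),\\ &\psi\big(s,\phi(J_S(s),r)\big)\,\psi(J_S(s),r)=\delta, \end{align*} for all $r,r'\in R$, all $s\in S$, and all $m\in\mathbb{Z}$ with $m\equiv m_1\ (\mathrm{mod}\ h_1)$ and $m\equiv m_2\ (\mathrm{mod}\ h_2)$. Then, for such $m$, the set $R\bowtie S:=R\times S$ with identity $(\delta,\delta)$ is an $m$-inverse loop with the multiplication $$(r,s)(r',s'):=\big(r\,\phi(s,r'),\,\psi(s,r')s'\big)$$ and the permutation $$J:R\bowtie S\to R\bowtie S,\qquad J(r,s):=(\delta,J_S(s))(J_R(r),\delta)=\big(\phi(J_S(s),J_R(r)),\,\psi(J_S(s),J_R(r))\big),$$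 if and only if the following holds for all $s,s'\in S$ and all $r\in R$: - if $m$ is even: $\phi(s,r)=r$ and $\psi(s,r)=s$; - if $m$ is odd: $$\phi\big(J_S^m(\psi(s,J_R^{-m}(r))s'),\,\phi(\psi(s,J_R^{-1}(r)),r)\big)=\phi(J_S^m(s'),r)$$ and $$\Big[\psi\big(J_S^m(\psi(s,r)s'),\,J_R^m(\phi(s,r))\big)\Big]J_S^{m+1}(s)=\psi\big(J_S^m(s'),J_R^m(r)\big).$$
   Context: A quasigroup is a set $Q$ with a binary multiplication such that for all $a,b\in Q$ there are unique $x,y\in Q$ with $ax=b$ and $ya=b$. A loop is a quasigroup with an identity element $\delta$, i.e. $x\delta=\delta x=x$ for all $x$. For $m\in\mathbb{Z}$, a loop $Q$ is an $m$-inverse loop (also called $m$-invertible loop) with permutation $J:Q\to Q$ if $J$ is a bijection satisfying $xJ(x)=\delta$ and $J^m(xy)\,J^{m+1}(x)=J^m(y)$ for all $x,y\in Q$. $\mathrm{Aut}(Q)$ denotes the group of bijections $f:Q\to Q$ with $f(xy)=f(x)f(y)$. *)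

(* Defs.v *)
From mathcomp Require Import all_boot all_order all_algebra.

Set Implicit Arguments.
Unset Strict Implicit.
Unset Printing Implicit Defensive.

Local Open Scope ring_scope.

(* [bijective] only asserts that an inverse exists; bundling the inverse (which
   is unique up to pointwise equality) makes negative powers available. *)
Record permutation (T : Type) := Permutation {
  perm_fun :> T -> T;
  perm_inv : T -> T;
  perm_funK : cancel perm_fun perm_inv;
  perm_invK : cancel perm_inv perm_fun
}.

(* [Negz n] is the integer [- n.+1]. *)
Definition zpow (T : Type) (J : permutation T) (m : int) : T -> T :=
  match m with
  | Posz n => iter n J
  | Negz n => iter n.+1 (perm_inv J)
  end.

Definition is_quasigroup (Q : Type) (mul : Q -> Q -> Q) : Prop :=
  forall a b : Q,
    (exists! x, mul a x = b) /\ (exists! y, mul y a = b).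

Definition is_loop (Q : Type) (mul : Q -> Q -> Q) (e : Q) : Prop :=
  is_quasigroup mul /\ (forall x, mul x e = x /\ mul e x = x).

Definition is_m_inverse_loop (Q : Type) (mul : Q -> Q -> Q) (e : Q)
    (m : int) (J : permutation Q) : Prop :=
  [/\ is_loop mul e,
      forall x, mul x (J x) = e
    & forall x y,
        mul (zpow J m (mul x y)) (zpow J (m + 1) x) = zpow J m y].

Definition is_automorphism (Q : Type) (mul : Q -> Q -> Q) (f : Q -> Q) : Prop :=
  bijective f /\ (forall x y, f (mul x y) = mul (f x) (f y)).

Definition bowtie_mul (R S : Type) (mulR : R -> R -> R) (mulS : S -> S -> S)
    (phi : S -> R -> R) (psi : S -> R -> S) (x y : R * S) : R * S :=
  (mulR x.1 (phi x.2 y.1), mulS (psi x.2 y.1) y.2).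

Definition bowtie_J (R S : Type) (mulR : R -> R -> R) (mulS : S -> S -> S)
    (deltaR : R) (deltaS : S) (phi : S -> R -> R) (psi : S -> R -> S)
    (JR : R -> R) (JS : S -> S) (x : R * S) : R * S :=
  bowtie_mul mulR mulS phi psi (deltaR, JS x.2) (JR x.1, deltaS).

(* Main.v *)
(* Writing J for both permutations, the hypotheses say that phi (J s) inverts
   phi s and that J (psi s r) = psi (J s) (phi s r), while the conditions at
   level m with r' = delta give J (phi s r) = phi (psi s r) (J r) and
   psi (psi s r) (J r) = s.  Hence R x S is always a loop, and the square of its
   permutation acts componentwise, as J^2 x J^2.  Even powers of the permutation
   are therefore componentwise, odd ones differ from an even one by a single
   application.  For m even, the m-inverse law with r = delta forces phi and psi
   to be trivial; for m odd, the conditions at level m turn the two components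
   of the law into the two stated identities. *)
Require Import Defs.
From mathcomp Require Import all_boot all_order all_algebra.
From mathcomp Require Import zify.

Local Open Scope ring_scope.

Import GRing.Theory.

Set Implicit Arguments.
Unset Strict Implicit.
Unset Printing Implicit Defensive.

(** * Integer powers of a permutation *)

Section IntegerPowers.

Variables (T U : Type) (J : permutation T) (K : permutation U).

Lemma zpow_succ m x : zpow J (m + 1) x = J (zpow J m x).
Proof.
case: m => [n|[|n]]; first by rewrite -[Posz n + 1]/(Posz (n + 1)) addn1.
  by rewrite /= perm_invK.
have -> : Negz n.+1 + 1 = Negz n by lia.
by rewrite [zpow J (Negz n.+1) x]/= perm_invK.
Qed.

Lemma zpow_pred m x : zpow J (m - 1) x = perm_inv J (zpow J m x).
Proof. by rewrite -{2}(subrK 1 m) zpow_succ perm_funK. Qed.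

Lemma zpowD m n x : zpow J (m + n) x = zpow J m (zpow J n x).
Proof.
elim/int_ind: m => [|m IH|m IH]; first by rewrite add0r.
  have -> : Posz m.+1 = m%:Z + 1 by lia.
  by rewrite addrAC !zpow_succ IH.
have -> : - Posz m.+1 = - m%:Z - 1 by lia.
by rewrite addrAC !zpow_pred IH.
Qed.

Lemma zpowK m : cancel (zpow J m) (zpow J (- m)).
Proof. by move=> x; rewrite -zpowD addNr. Qed.

Lemma zpowNK m : cancel (zpow J (- m)) (zpow J m).
Proof. by move=> x; rewrite -zpowD addrN. Qed.

Lemma zpow_inj m : injective (zpow J m).
Proof. exact: can_inj (zpowK m). Qed.

(** Injectivity of [K] carries the relation over to the inverse permutations, which covers negative
    powers. *)
Lemma zpow_semiconj (f : T -> U) :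
  (forall x, K (f x) = f (J x)) -> forall m x, zpow K m (f x) = f (zpow J m x).
Proof.
move=> Kf; have iKf x : perm_inv K (f x) = f (perm_inv J x).
  by apply: (can_inj (@perm_funK _ K)); rewrite perm_invK Kf perm_invK.
by case=> n x; rewrite /zpow; [elim: n => //= n -> | elim: n.+1 => //= k ->].
Qed.

Lemma zpow_fix x m : J x = x -> zpow J m x = x.
Proof.
move=> Jx; have iJx : perm_inv J x = x by rewrite -{1}Jx perm_funK.
by case: m => n; rewrite /zpow; [elim: n => //= n -> | elim: n.+1 => //= k ->].
Qed.

Definition perm_sq : permutation T :=
  Permutation (can_comp (@perm_funK _ J) (@perm_funK _ J))
              (can_comp (@perm_invK _ J) (@perm_invK _ J)).

Lemma zpow_sq k x : zpow perm_sq k x = zpow J (k * 2) x.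
Proof.
case: k => n; first by rewrite -PoszM /zpow iterM.
have -> : Negz n * 2 = Negz (n * 2).+1 by lia.
by rewrite /zpow -[(n * 2).+2]/(n.+1 * 2)%N iterM.
Qed.

End IntegerPowers.

(** This is [zpow_semiconj] for the squares; the maps met below are intertwined only after
    squaring. *)
Lemma zpow_semiconj_even (T U : Type) (J : permutation T) (K : permutation U)
    (f : T -> U) :
  (forall x, K (K (f x)) = f (J (J x))) ->
  forall k x, zpow K (k * 2) (f x) = f (zpow J (k * 2) x).
Proof.
move=> KKf k x; rewrite -!zpow_sq.
exact: (@zpow_semiconj _ _ (perm_sq J) (perm_sq K)).
Qed.

Section ProductPermutation.

Variables (T U : Type) (J : permutation T) (K : permutation U).

Lemma perm_prod_funK :
  cancel (fun x : T * U => (J x.1, K x.2))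
         (fun x => (perm_inv J x.1, perm_inv K x.2)).
Proof. by case=> x y; rewrite /= !perm_funK. Qed.

Lemma perm_prod_invK :
  cancel (fun x : T * U => (perm_inv J x.1, perm_inv K x.2))
         (fun x => (J x.1, K x.2)).
Proof. by case=> x y; rewrite /= !perm_invK. Qed.

Definition perm_prod : permutation (T * U) :=
  Permutation perm_prod_funK perm_prod_invK.

(** Each projection semiconjugates the product permutation to one factor. *)
Lemma zpow_prod m x y : zpow perm_prod m (x, y) = (zpow J m x, zpow K m y).
Proof.
rewrite [LHS]surjective_pairing.
rewrite -(@zpow_semiconj _ _ perm_prod J fst) //.
by rewrite -(@zpow_semiconj _ _ perm_prod K snd).
Qed.

End ProductPermutation.

(** * Cancellation, and change of exponent in an inverse loop *)

Section InverseLoop.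

Variables (Q : Type) (mul : Q -> Q -> Q) (e : Q).

Lemma quasigroup_mulI : is_quasigroup mul -> forall a, injective (mul a).
Proof.
move=> qQ a x y axy; have [[z [_ uz]] _] := qQ a (mul a y).
by rewrite -(uz x axy) -(uz y erefl).
Qed.

Lemma quasigroup_mulIr : is_quasigroup mul -> forall a, injective (mul^~ a).
Proof.
move=> qQ a x y /= xya; have [_ [z [_ uz]]] := qQ a (mul y a).
by rewrite -(uz x xya) -(uz y erefl).
Qed.

Variable J : permutation Q.

Lemma zpow_morphismM h k :
    {morph zpow J h : x y / mul x y} ->
  {morph zpow J (k * h) : x y / mul x y}.
Proof.
move=> hJ; have nJ (n : nat) : {morph zpow J (n%:Z * h) : x y / mul x y}.
  elim: n => [|n IH] x y; first by rewrite mul0r.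
  by rewrite intS mulrDl mul1r !zpowD IH hJ.
(* For a negative multiple, apply the opposite power, an injective morphism, to both sides. *)
case: k => n //; rewrite NegzE mulNr => x y.
by apply: (@zpow_inj _ J (n.+1%:Z * h)); rewrite nJ !zpowNK.
Qed.

(** Write [n = k * h + m] and apply the morphism [J^(k h)] to the law at exponent [m]. *)
Lemma m_inverse_loop_mod m n h :
    is_automorphism mul (zpow J h) -> (n = m %[mod h])%Z ->
  is_m_inverse_loop mul e m J -> is_m_inverse_loop mul e n J.
Proof.
move=> [_ hJ] nm [lQ xJ mQ]; split=> // x y.
have [k ->] : exists k, n = k * h + m.
  exists ((n %/ h)%Z - (m %/ h)%Z).
  by rewrite {1}(divz_eq n h) {2}(divz_eq m h) nm mulrBl; lia.
by rewrite -addrA !(zpowD _ (k * h)) -(zpow_morphismM _ hJ) mQ.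
Qed.

End InverseLoop.

(** * The loop and the permutation on [R * S] *)

Section Bowtie.

Variables (R S : Type).
Variables (mulR : R -> R -> R) (deltaR : R) (JR : permutation R).
Variables (mulS : S -> S -> S) (deltaS : S) (JS : permutation S).
Variables (m : int) (phi : S -> R -> R) (psi : S -> R -> S).
Hypothesis hR : is_m_inverse_loop mulR deltaR m JR.
Hypothesis hJR : JR deltaR = deltaR.
Hypothesis hS : is_m_inverse_loop mulS deltaS m JS.
Hypothesis hJS : JS deltaS = deltaS.
Hypothesis hphi_deltal : forall r, phi deltaS r = r.
Hypothesis hphi_deltar : forall s, phi s deltaR = deltaR.
Hypothesis hpsi_deltal : forall r, psi deltaS r = deltaS.
Hypothesis hpsi_deltar : forall s, psi s deltaR = s.
Hypothesis hphi_J : forall s r, phi s (phi (JS s) r) = r.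
Hypothesis hpsi_m : forall s r r',
  psi (psi s (zpow JR m (mulR r r'))) (zpow JR (m + 1) r)
  = psi s (zpow JR m r').
Hypothesis hphi_m : forall s r r',
  mulR (phi s (zpow JR m (mulR r r')))
       (phi (psi s (zpow JR m (mulR r r'))) (zpow JR (m + 1) r))
  = phi s (zpow JR m r').
Hypothesis hpsi_J :
  forall s r, mulS (psi s (phi (JS s) r)) (psi (JS s) r) = deltaS.

Let mulR1 r : mulR r deltaR = r. Proof. by have [[_ /(_ r)[]]] := hR. Qed.
Let mul1R r : mulR deltaR r = r. Proof. by have [[_ /(_ r)[]]] := hR. Qed.
Let mulS1 s : mulS s deltaS = s. Proof. by have [[_ /(_ s)[]]] := hS. Qed.
Let mul1S s : mulS deltaS s = s. Proof. by have [[_ /(_ s)[]]] := hS. Qed.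
Let mulRJ r : mulR r (JR r) = deltaR. Proof. by have [_ ->] := hR. Qed.
Let mulSJ s : mulS s (JS s) = deltaS. Proof. by have [_ ->] := hS. Qed.
Let qR : is_quasigroup mulR. Proof. by have [[]] := hR. Qed.
Let qS : is_quasigroup mulS. Proof. by have [[]] := hS. Qed.

Local Notation bmul := (bowtie_mul mulR mulS phi psi).
Local Notation bJ := (bowtie_J mulR mulS deltaR deltaS phi psi JR JS).

Lemma bowtie_JE r s : bJ (r, s) = (phi (JS s) (JR r), psi (JS s) (JR r)).
Proof. by rewrite /bowtie_J /bowtie_mul /= mul1R mulS1. Qed.

(** The map [phi (JS t)] has left inverse [phi t] and right inverse [phi (JS (JS t))], so these two
    agree; every [s] is some [JS t]. *)
Lemma phi_JK s r : phi (JS s) (phi s r) = r.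
Proof.
rewrite -[s](@perm_invK _ JS); set t := perm_inv JS s.
rewrite -{2}[r](hphi_J t) -{2}[phi (JS t) r](hphi_J (JS t)).
by rewrite !hphi_J.
Qed.

(** Both sides are right inverses of [psi s r], the second by [hpsi_J] at [phi s r]. *)
Lemma JS_psi s r : JS (psi s r) = psi (JS s) (phi s r).
Proof.
apply: (quasigroup_mulI qS (a := psi s r)).
by rewrite mulSJ -{1}[r](phi_JK s) hpsi_J.
Qed.

Lemma psi_psiJ s r : psi (psi s r) (JR r) = s.
Proof.
(* The argument [JR^(-m) r] cancels the power [m], leaving [r] and [JR r]. *)
have := hpsi_m s (zpow JR (- m) r) deltaR.
by rewrite mulR1 zpow_succ zpowNK zpow_fix // hpsi_deltar.
Qed.

(** Uniqueness of right inverses in [R]: [hphi_m] with [r' = deltaR] shows that the right side is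
    one for [phi s r]. *)
Lemma JR_phi s r : JR (phi s r) = phi (psi s r) (JR r).
Proof.
apply: (quasigroup_mulI qR (a := phi s r)); rewrite mulRJ.
have := hphi_m s (zpow JR (- m) r) deltaR.
by rewrite mulR1 zpow_succ zpowNK (zpow_fix m hJR) hphi_deltar.
Qed.

Lemma JR2_phi s r : JR (JR (phi s r)) = phi s (JR (JR r)).
Proof. by rewrite !JR_phi psi_psiJ. Qed.

(* For m odd this is [J^m (phi s r)], since even powers of J commute with
   [phi s]. *)
Lemma zpow_phi_odd k s r :
  zpow JR (k * 2 + 1) (phi s r)
  = phi (psi s (zpow JR (k * 2) r)) (zpow JR (k * 2 + 1) r).
Proof.
rewrite !zpow_succ (@zpow_semiconj_even _ _ JR JR (phi s)) ?JR_phi //.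
by move=> x; rewrite JR2_phi.
Qed.

Lemma bowtie_loop : is_loop bmul (deltaR, deltaS).
Proof.
split=> [[r s] [a b]|[r s]]; last first.
  by split; rewrite /bowtie_mul /= ?hphi_deltar ?hphi_deltal ?hpsi_deltal
    ?hpsi_deltar ?mulR1 ?mulS1 ?mul1R ?mul1S.
split.
  (* Left division: solve in [R] for [x = phi s u], recover [u = phi (JS s) x], then solve in
     [S]. *)
  have [[x [ax _]] _] := qR r a.
  have [[y [ay _]] _] := qS (psi s (phi (JS s) x)) b.
  exists (phi (JS s) x, y); split=> [|[u v]]; rewrite /bowtie_mul /=.
    by rewrite hphi_J ax ay.
  case=> au; rewrite -ax in au; rewrite -(quasigroup_mulI qR au) phi_JK in ay *.
  by rewrite -ay => /(quasigroup_mulI qS) ->.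
(* Right division: solve in [S] for [t = psi v r] first. By [psi_psiJ], the map sending [t] to
   [psi t (JR^(-1) r)] inverts the one sending [v] to [psi v r]. *)
have [_ [t [bt _]]] := qS s b; pose v := psi t (perm_inv JR r).
have psi_v : psi v r = t by rewrite -(psi_psiJ t (perm_inv JR r)) perm_invK.
have [_ [u [au _]]] := qR (phi v r) a.
exists (u, v); split=> [|[u' v']]; rewrite /bowtie_mul /= ?psi_v ?au ?bt //.
case=> au'; rewrite -bt => /(quasigroup_mulIr qS) tv'.
have vv' : v = v' by rewrite -(psi_psiJ v r) psi_v -tv' psi_psiJ.
by move: au'; rewrite -vv' -au => /(quasigroup_mulIr qR) ->.
Qed.

Lemma bowtie_mulJ x : bmul x (bJ x) = (deltaR, deltaS).
Proof.
case: x => r s; rewrite bowtie_JE /bowtie_mul /=.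
by rewrite hphi_J hpsi_J mulRJ.
Qed.

Lemma bowtie_J2 r s : bJ (bJ (r, s)) = (JR (JR r), JS (JS s)).
Proof. by rewrite !bowtie_JE JS_psi -JR_phi phi_JK psi_psiJ. Qed.

(** The square of [bJ] is a permutation [K], so [bJ] is injective and [bJ \o perm_inv K] is its
    two-sided inverse. *)
Lemma bowtie_perm : exists J : permutation (R * S), J =1 bJ.
Proof.
pose K := perm_prod (perm_sq JR) (perm_sq JS).
have bJ2 x : bJ (bJ x) = K x by case: x => r s; rewrite bowtie_J2.
have bJ_inj : injective bJ.
  by move=> x y xy; apply: (can_inj (@perm_funK _ K)); rewrite -!bJ2 xy.
have invK : cancel (bJ \o perm_inv K) bJ by move=> x; rewrite /= bJ2 perm_invK.
have funK : cancel bJ (bJ \o perm_inv K) by move=> x; apply: bJ_inj; rewrite invK.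
by exists (Permutation funK invK).
Qed.

(** * The [m]-inverse law on the product, by parity of [m] *)

Section MInverseLaw.

Variable J : permutation (R * S).
Hypothesis JE : J =1 bJ.

(** [J] and [perm_prod JR JS] have the same square, so the identity map intertwines their even
    powers. *)
Lemma zpow_bowtie_even k r s :
  zpow J (k * 2) (r, s) = (zpow JR (k * 2) r, zpow JS (k * 2) s).
Proof.
rewrite (@zpow_semiconj_even _ _ (perm_prod JR JS) J id) ?zpow_prod //.
by case=> x y; rewrite !JE bowtie_J2.
Qed.

Lemma zpow_bowtie_odd k r s :
  zpow J (k * 2 + 1) (r, s)
  = (phi (zpow JS (k * 2 + 1) s) (zpow JR (k * 2 + 1) r),
     psi (zpow JS (k * 2 + 1) s) (zpow JR (k * 2 + 1) r)).
Proof. by rewrite zpow_succ zpow_bowtie_even JE bowtie_JE -!zpow_succ. Qed.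

Lemma m_inverse_law_even : (2 %| m)%Z ->
  (forall x y, bmul (zpow J m (bmul x y)) (zpow J (m + 1) x) = zpow J m y)
  <-> (forall s r, phi s r = r /\ psi s r = s).
Proof.
have [_ _ mR] := hR; have [_ _ mS] := hS.
case/dvdzP=> k mE; split=> [law s r | triv [r s] [r' s']]; last first.
  rewrite /bowtie_mul !mE !zpow_bowtie_even zpow_bowtie_odd -!mE /=.
  by rewrite !(triv _ _).1 !(triv _ _).2 mR mS.
(* With this choice [J^(m+1)] sends the left factor to [(deltaR, JS^(m+1) s)], so the right
   multiplication leaves the first component unchanged. *)
have := law (deltaR, s) (r, deltaS).
rewrite /bowtie_mul mE !zpow_bowtie_even zpow_bowtie_odd -!mE /=.
rewrite !(@zpow_fix _ JR deltaR) // !hphi_deltar !hpsi_deltar mul1R mulR1 mulS1.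
case=> eqR eqS; split; first exact: zpow_inj eqR.
(* The law of [S] at [y = deltaS] gives a second left inverse of [JS^(m+1) s]; cancel on the
   right. *)
have := mS s deltaS; rewrite mulS1 -eqS => /(quasigroup_mulIr qS).
by move=> eqs; apply: esym; exact: zpow_inj eqs.
Qed.

Lemma m_inverse_law_odd : ~~ (2 %| m)%Z ->
  (forall x y, bmul (zpow J m (bmul x y)) (zpow J (m + 1) x) = zpow J m y)
  <-> (forall s s' r,
      phi (zpow JS m (mulS (psi s (zpow JR (- m) r)) s'))
          (phi (psi s (zpow JR (- 1) r)) r)
      = phi (zpow JS m s') r
      /\
      mulS (psi (zpow JS m (mulS (psi s r) s')) (zpow JR m (phi s r)))
           (zpow JS (m + 1) s)
      = psi (zpow JS m s') (zpow JR m r)).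
Proof.
move=> m_odd; have [k mE] : exists k, m = k * 2 + 1.
  by exists (m %/ 2)%Z; lia.
have m1E : m + 1 = (k + 1) * 2 by lia.
have zphi s r : zpow JR m (phi s r)
    = phi (psi s (zpow JR (- 1) (zpow JR m r))) (zpow JR m r).
  by rewrite -[zpow JR (- 1) _]zpowD mE [- 1 + _]addrC addrK zpow_phi_odd.
(* Applied to [mulR r (phi s r')], [hphi_m] and [hpsi_m] absorb [JR^(m+1) r], so [r] drops out of
   both components and may be set to [deltaR]. *)
have lawE r s r' s' :
    (bmul (zpow J m (bmul (r, s) (r', s'))) (zpow J (m + 1) (r, s))
     = zpow J m (r', s'))
    <-> phi (zpow JS m (mulS (psi s r') s')) (zpow JR m (phi s r'))
        = phi (zpow JS m s') (zpow JR m r')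
     /\ mulS (psi (zpow JS m (mulS (psi s r') s')) (zpow JR m (phi s r')))
             (zpow JS (m + 1) s)
        = psi (zpow JS m s') (zpow JR m r').
  rewrite /bowtie_mul m1E zpow_bowtie_even -m1E mE !zpow_bowtie_odd -mE /=.
  rewrite hphi_m hpsi_m.
  by split=> [[-> ->] | [-> ->]].
split=> [law s s' r | eqs [r s] [r' s']].
  split; last by have [] := (lawE deltaR s r s').1 (law _ _).
  (* The first stated identity is the first component after the change of variable [r' = JR^(-m) r],
     rewritten by [zphi]. *)
  have [+ _] := (lawE deltaR s (zpow JR (- m) r) s').1 (law _ _).
  by rewrite zphi zpowNK.
apply/lawE; split; last by have [] := eqs s s' r'.
by have [+ _] := eqs s s' (zpow JR m r'); rewrite zpowK zphi.
Qed.

End MInverseLaw.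

End Bowtie.

Theorem proposition2p9 (R S : Type)
  (mulR : R -> R -> R) (deltaR : R) (JR : permutation R)
  (mulS : S -> S -> S) (deltaS : S) (JS : permutation S)
  (m1 m2 h1 h2 : int)
  (hR : is_m_inverse_loop mulR deltaR m1 JR)
  (hJR : JR deltaR = deltaR)
  (hAutR : is_automorphism mulR (zpow JR h1))
  (hS : is_m_inverse_loop mulS deltaS m2 JS)
  (hJS : JS deltaS = deltaS)
  (hAutS : is_automorphism mulS (zpow JS h2))
  (phi : S -> R -> R) (psi : S -> R -> S)
  (hphi_deltal : forall r, phi deltaS r = r)
  (hphi_deltar : forall s, phi s deltaR = deltaR)
  (hpsi_deltal : forall r, psi deltaS r = deltaS)
  (hpsi_deltar : forall s, psi s deltaR = s)
  (hphi_J : forall s r, phi s (phi (JS s) r) = r)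
  (hpsi_m : forall m : int,
    (m = m1 %[mod h1])%Z -> (m = m2 %[mod h2])%Z ->
    forall s r r',
      psi (psi s (zpow JR m (mulR r r'))) (zpow JR (m + 1) r)
      = psi s (zpow JR m r'))
  (hphi_m : forall m : int,
    (m = m1 %[mod h1])%Z -> (m = m2 %[mod h2])%Z ->
    forall s r r',
      mulR (phi s (zpow JR m (mulR r r')))
           (phi (psi s (zpow JR m (mulR r r'))) (zpow JR (m + 1) r))
      = phi s (zpow JR m r'))
  (hpsi_J : forall s r, mulS (psi s (phi (JS s) r)) (psi (JS s) r) = deltaS)
  (m : int)
  (hm1 : (m = m1 %[mod h1])%Z) (hm2 : (m = m2 %[mod h2])%Z) :
  (forall r s,
     bowtie_J mulR mulS deltaR deltaS phi psi JR JS (r, s)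
     = (phi (JS s) (JR r), psi (JS s) (JR r)))
  /\
  ((exists J : permutation (R * S),
      (forall x, J x = bowtie_J mulR mulS deltaR deltaS phi psi JR JS x) /\
      is_m_inverse_loop (bowtie_mul mulR mulS phi psi) (deltaR, deltaS) m J)
   <->
   ((2 %| m)%Z -> forall s r, phi s r = r /\ psi s r = s) /\
   (~~ (2 %| m)%Z -> forall s s' r,
      phi (zpow JS m (mulS (psi s (zpow JR (- m) r)) s'))
          (phi (psi s (zpow JR (- 1) r)) r)
      = phi (zpow JS m s') r
      /\
      mulS (psi (zpow JS m (mulS (psi s r) s')) (zpow JR m (phi s r)))
           (zpow JS (m + 1) s)
      = psi (zpow JS m s') (zpow JR m r))).
Proof.
(* The two congruences make both factors [m]-inverse for the same [m]. *)
have hR' := m_inverse_loop_mod hAutR hm1 hR.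
have hS' := m_inverse_loop_mod hAutS hm2 hS.
have {hphi_m}hphi_m := hphi_m m hm1 hm2.
have {hpsi_m}hpsi_m := hpsi_m m hm1 hm2.
split=> [r s|]; first exact: (bowtie_JE _ _ hR' hS').
split=> [[J [JE [_ _ law]]] | [evenH oddH]].
  split=> [even_m | odd_m].
    exact: (m_inverse_law_even hR' hJR hS' hphi_deltar hpsi_deltar hphi_J
      hpsi_m hphi_m hpsi_J JE even_m).1 law.
  exact: (m_inverse_law_odd hR' hJR hS' hphi_deltar hpsi_deltar hphi_J
    hpsi_m hphi_m hpsi_J JE odd_m).1 law.
have [J JE] := bowtie_perm hR' hJR hS' hphi_deltar hpsi_deltar hphi_J
  hpsi_m hphi_m hpsi_J.
exists J; split=> //; split.
- exact: (bowtie_loop hR' hJR hS').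
- by move=> x; rewrite JE (bowtie_mulJ hR' hS').
have [even_m | odd_m] := boolP (2 %| m)%Z.
  exact: (m_inverse_law_even hR' hJR hS' hphi_deltar hpsi_deltar hphi_J
    hpsi_m hphi_m hpsi_J JE even_m).2 (evenH even_m).
exact: (m_inverse_law_odd hR' hJR hS' hphi_deltar hpsi_deltar hphi_J
  hpsi_m hphi_m hpsi_J JE odd_m).2 (oddH odd_m).
Qed.
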